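(* Let $n\ge3$, $p=\lfloor\frac{n+1}{2}\rfloor$, and consider the dihedral model arrangement $D_n=\{h,h_1,\dots,h_n\}$ in $\mathbb R^3$, with its regions ordered as in the context. Its $q$-Varchenko matrix is the $2(np+1)\times2(np+1)$ matrix with block form $$V_q=\begin{pmatrix}\overline Q_0&\overline Q_1&\overline Q_2&\cdots&\overline Q_p\\ \overline Q_1^t&\overline C_{11}&\overline C_{12}&\cdots&\overline C_{1p}\\ \overline Q_2^t&\overline C_{12}^t&\overline C_{22}&\cdots&\overline C_{2p}\\ \vdots&\vdots&\vdots&\ddots&\vdots\\ \overline Q_p^t&\overline C_{1p}^t&\overline C_{2p}^t&\cdots&\overline C_{pp}\end{pmatrix},$$ where $$\overline Q_i=\begin{pmatrix}Q_i & q Q_i\\ q Q_i & Q_i\end{pmatrix}\ (0\le i\le p),\qquad \overline C_{ij}=\begin{pmatrix}C_{ij} & q J^{i-1}KC_{ij}\\ q J^{i-1}KC_{ij} & C_{ij}\end{pmatrix}\ (1\le i\le j\le p).$$ Here $Q_0=1$; $Q_r=(q^r,\dots,q^r)$ is the row vector of length $n$ for $r\ge 1$; $J$ is the $n\times n$ circulant matrix with first row $(0,1,0,\dots,0)$; $K$ is the $n\times n$ matrix with ones on the antidiagonal and zeros elsewhere; and for $1\le i\le j\le p$, $C_{ij}$ is the $n\times n$ circulant matrix with first row $$\big(q^{j-i},q^{j-i+2},\dots,q^{j-i+2(i-1)},\ \underbrace{q^{i+j},\dots,q^{i+j}}_{n+1-i-j},\ q^{j-i+2(i-1)},q^{j-i+2(i-2)},\dots,q^{j-i+2},\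 \underbrace{q^{j-i},\dots,q^{j-i}}_{j-i}\big)$$ (the first group has $i$ entries, the third group has $i-1$ entries).
   Context: For a hyperplane arrangement, the regions are the connected components of the complement of the union of the hyperplanes; $sep(R,R')$ is the set of hyperplanes separating $R$ from $R'$. The $q$-Varchenko matrix $V_q$ is indexed by the regions, with $(R,R')$-entry $q^{\#sep(R,R')}$. Dihedral model $D_n$: take the lines extending the edges of a regular $n$-gon, numbered consecutively counter-clockwise, and replace each by the plane in $\mathbb R^3$ through it perpendicular to the plane of the $n$-gon, giving planes $h_1,\dots,h_n$ (indices mod $n$) bounding a regular $n$-gonal cylinder; add one plane $h$ perpendicular to all of $h_1,\dots,h_n$. Labelling: regions above $h$ carry a superscript $+$, regions below $h$ a superscript $-$. $R_0^{\pm}$ are the two regions inside the cylinder. For $1\le r\le p$, $1\le x\le n$: $R^+_{(r-1)n+x}$ is the region above $h$ with $sep(R_0^+,R^+_{(r-1)n+x})=\{h_x,h_{x+1},\dots,h_{x+r-1}\}$, and $R^-_{(r-1)n+x}$ is the region below $h$ with $sep(R_0^-,R^-_{(r-1)n+x})=\{h_{n+1-x},h_{n+1-(x+1)},\dots,h_{n+1-(x+r-1)}\}$ (indices mod $n$). The regions are ordered: $R_0^+,R_0^-$, then for $r=1,\dots,p$ successively $R^+_{(r-1)n+1},\dots,R^+_{rn},R^-_{(r-1)n+1},\dots,R^-_{rn}$. The circulant matrix with first row $(a_1,\dots,a_n)$ has each subsequent row equal to the cyclic right shift of the preceding one, so its second row is $(a_n,a_1,\dots,a_{n-1})$. $M^t$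 is the transpose. *)

(* Defs.v *)
From HB Require Import structures.
From mathcomp Require Import all_boot all_order all_algebra.
From mathcomp Require Import all_classical all_reals all_analysis.

Set Implicit Arguments.
Unset Strict Implicit.
Unset Printing Implicit Defensive.

Import Order.TTheory GRing.Theory Num.Theory.
Import numFieldNormedType.Exports.

Local Open Scope classical_set_scope.
Local Open Scope ring_scope.

(* The pair (u, b) stands for the affine hyperplane {x | <u, x> = b}. *)
Definition hyperplane (R : realType) (d : nat) := ('rV[R]_d * R)%type.

Definition heval (R : realType) (d : nat) (H : hyperplane R d) (x : 'rV[R]_d) : R :=
  \sum_(i < d) H.1 0 i * x 0 i - H.2.

Definition hpoints (R : realType) (d : nat) (H : hyperplane R d) : set 'rV[R]_d :=
  [set x | heval H x = 0].

Definition pos_side (R : realType) (d : nat) (H : hyperplane R d) : set 'rV[R]_d :=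
  [set x | 0 < heval H x].

Definition neg_side (R : realType) (d : nat) (H : hyperplane R d) : set 'rV[R]_d :=
  [set x | heval H x < 0].

Definition arr_complement (R : realType) (d : nat) (I : finType)
    (A : I -> hyperplane R d) : set 'rV[R]_d :=
  ~` (\bigcup_(i in [set: I]) hpoints (A i)).

Definition regions (R : realType) (d : nat) (I : finType)
    (A : I -> hyperplane R d) : set (set 'rV[R]_d) :=
  [set C | exists2 x, arr_complement A x &
           C = connected_component (arr_complement A) x].

Definition separates (R : realType) (d : nat) (H : hyperplane R d)
    (C C' : set 'rV[R]_d) : Prop :=
  (C `<=` pos_side H /\ C' `<=` neg_side H) \/
  (C `<=` neg_side H /\ C' `<=` pos_side H).

Definition sep (R : realType) (d : nat) (I : finType)
    (A : I -> hyperplane R d) (C C' : set 'rV[R]_d) : {set I} :=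
  [set i : I | `[< separates (A i) C C' >]]%SET.

(* q-Varchenko matrix, the N regions being listed as s 0, ..., s (N - 1). *)
Definition varchenko (T : comNzRingType) (q : T) (R : realType) (d : nat)
    (I : finType) (A : I -> hyperplane R d) (N : nat)
    (s : nat -> set 'rV[R]_d) : 'M[T]_N :=
  \matrix_(i < N, j < N) q ^+ #|sep A (s i) (s j)|.

Definition pt3 (R : realType) (x y z : R) : 'rV[R]_3 :=
  \row_(i < 3) [:: x; y; z]`_i.

(* Vertices, in counter-clockwise order, of a regular n-gon with centre c and
   circumradius rho lying in a horizontal plane of R^3. *)
Definition ngon_vertex (R : realType) (n : nat) (c : 'rV[R]_3) (rho theta : R)
    (k : nat) : 'rV[R]_3 :=
  let phi := theta + 2 * pi * k%:R / n%:R in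
  c + rho *: pt3 (cos phi) (sin phi) 0.

(* The vertical plane through v and w, for v and w in a same horizontal plane:
   its normal vector is horizontal and orthogonal to w - v. *)
Definition vertical_plane (R : realType) (v w : 'rV[R]_3) : hyperplane R 3 :=
  let e := w - v in
  let u := pt3 (e 0 1) (- e 0 0) 0 in
  (u, \sum_(i < 3) u 0 i * v 0 i).

Definition horizontal_plane (R : realType) (z0 : R) : hyperplane R 3 :=
  (pt3 0 0 1, z0).

(* None is h, at height z0; Some k, for 0 <= k < n, is h_k, so that Some 0 is
   h_0 = h_n. *)
Definition dihedral_model (R : realType) (n : nat) (c : 'rV[R]_3)
    (rho theta z0 : R) (i : option 'I_n) : hyperplane R 3 :=
  if i is Some k then
    vertical_plane (ngon_vertex n c rho theta k) (ngon_vertex n c rho theta k.+1)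
  else horizontal_plane z0.

(* The points lying on the same side as c of each plane h_k; c is on the axis. *)
Definition cylinder (R : realType) (n : nat) (c : 'rV[R]_3)
    (rho theta z0 : R) : set 'rV[R]_3 :=
  [set x | forall k : 'I_n,
     0 < heval (dihedral_model c rho theta z0 (Some k)) x *
         heval (dihedral_model c rho theta z0 (Some k)) c].

(* {h_x, h_(x+1), ..., h_(x+r-1)}, indices mod n. *)
Definition arc_plus (n r x : nat) : {set option 'I_n} :=
  [set Some i | i : 'I_n in [pred i : 'I_n |
     [exists t : 'I_r, (i == x + t %[mod n])%N]]]%SET.

(* {h_(n+1-x), h_(n+1-(x+1)), ..., h_(n+1-(x+r-1))}, indices mod n; the
   congruence i = n + 1 - (x + t) is written without a subtraction. *)
Definition arc_minus (n r x : nat) : {set option 'I_n} :=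
  [set Some i | i : 'I_n in [pred i : 'I_n |
     [exists t : 'I_r, (i + (x + t) == n + 1 %[mod n])%N]]]%SET.

(* Rp k is R^+_k and Rm k is R^-_k, for 0 <= k <= n * p. *)
Record dihedral_labelling (R : realType) (n p : nat) (c : 'rV[R]_3)
    (rho theta z0 : R) (Rp Rm : nat -> set 'rV[R]_3) : Prop := {
  lab_plus0 :
    [/\ regions (@dihedral_model R n c rho theta z0) (Rp 0%N),
        Rp 0%N `<=` pos_side (horizontal_plane z0) &
        Rp 0%N `<=` @cylinder R n c rho theta z0];
  lab_minus0 :
    [/\ regions (@dihedral_model R n c rho theta z0) (Rm 0%N),
        Rm 0%N `<=` neg_side (horizontal_plane z0) &
        Rm 0%N `<=` @cylinder R n c rho theta z0];
  lab_plus : forall r x : nat, (1 <= r <= p)%N -> (1 <= x <= n)%N ->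
    [/\ regions (@dihedral_model R n c rho theta z0) (Rp ((r - 1) * n + x)%N),
        Rp ((r - 1) * n + x)%N `<=` pos_side (horizontal_plane z0) &
        sep (@dihedral_model R n c rho theta z0) (Rp 0%N)
          (Rp ((r - 1) * n + x)%N) = arc_plus n r x];
  lab_minus : forall r x : nat, (1 <= r <= p)%N -> (1 <= x <= n)%N ->
    [/\ regions (@dihedral_model R n c rho theta z0) (Rm ((r - 1) * n + x)%N),
        Rm ((r - 1) * n + x)%N `<=` neg_side (horizontal_plane z0) &
        sep (@dihedral_model R n c rho theta z0) (Rm 0%N)
          (Rm ((r - 1) * n + x)%N) = arc_minus n r x]
}.

Definition region_order (S : Type) (n p : nat) (Rp Rm : nat -> S) : seq S :=
  [:: Rp 0%N; Rm 0%N] ++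
  flatten [seq [seq Rp ((r - 1) * n + x)%N | x <- iota 1 n] ++
               [seq Rm ((r - 1) * n + x)%N | x <- iota 1 n] | r <- iota 1 p].

Definition circulant (T : nzRingType) (n : nat) (s : seq T) : 'M[T]_n :=
  \matrix_(x < n, y < n) (rotr x s)`_y.

Definition Jmx (T : nzRingType) (n : nat) : 'M[T]_n :=
  circulant n [:: 0, 1 & nseq (n - 2) 0].

Definition Kmx (T : nzRingType) (n : nat) : 'M[T]_n :=
  \matrix_(x < n, y < n) (y == rev_ord x)%:R.

Definition C_row (T : nzRingType) (q : T) (n i j : nat) : seq T :=
  [seq q ^+ (j - i + 2 * k) | k <- iota 0 i] ++
  nseq (n + 1 - i - j) (q ^+ (i + j)) ++
  [seq q ^+ (j - i + 2 * k) | k <- rev (iota 1 (i - 1))] ++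
  nseq (j - i) (q ^+ (j - i)).

Definition Cmx (T : nzRingType) (q : T) (n i j : nat) : 'M[T]_n :=
  circulant n (C_row q n i j).

Definition Cbar (T : nzRingType) (q : T) (n i j : nat) : 'M[T]_(n + n, n + n) :=
  let D := q *: (Jmx T n ^+ (i - 1) *m Kmx T n *m Cmx q n i j) in
  block_mx (Cmx q n i j) D D (Cmx q n i j).

Definition Qbar (T : nzRingType) (q : T) (m : nat) (Q : 'M[T]_(1, m)) :
    'M[T]_(1 + 1, m + m) :=
  block_mx Q (q *: Q) (q *: Q) Q.

Definition Qbar0 (T : nzRingType) (q : T) : 'M[T]_(1 + 1, 1 + 1) :=
  Qbar q (1%:M : 'M[T]_(1, 1)).

Definition Qbar_pos (T : nzRingType) (q : T) (n r : nat) : 'M[T]_(1 + 1, n + n) :=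
  Qbar q (const_mx (q ^+ r) : 'M[T]_(1, n)).

(* The ordinals i, j < p stand for the block indices i.+1, j.+1 in 1..p. *)
Definition Vblocks (T : nzRingType) (q : T) (n p : nat) :
    'M[T]_((1 + 1) + \sum_(r < p) (n + n)) :=
  block_mx
    (Qbar0 q)
    (\mxrow_(j < p) Qbar_pos q n j.+1)
    (\mxcol_(i < p) (Qbar_pos q n i.+1)^T)
    (\mxblock_(i < p, j < p)
       if (i <= j)%N then Cbar q n i.+1 j.+1 else (Cbar q n j.+1 i.+1)^T).

Lemma Vblocks_dim (n p : nat) :
  ((1 + 1) + \sum_(r < p) (n + n) = 2 * (n * p + 1))%N.
Proof.
rewrite sum_nat_const card_ord [RHS]mulnDr muln1 addnC; congr (_ + _)%N.
by rewrite addnn -mul2n mulnCA [(p * n)%N]mulnC.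
Qed.

(* Main.v *)
Require Import Defs.
From HB Require Import structures.
From mathcomp Require Import all_boot all_order all_algebra.
From mathcomp Require Import all_classical all_reals all_analysis.
From mathcomp Require Import zify ring lra.

Set Implicit Arguments.
Unset Strict Implicit.
Unset Printing Implicit Defensive.

Import Order.TTheory GRing.Theory Num.Theory.
Import numFieldNormedType.Exports.

Local Open Scope classical_set_scope.
Local Open Scope ring_scope.

(** Each [h_k] is a tangent plane of the vertical cylinder inscribed in the prism,
and a point at horizontal distance [t] and polar angle [alpha] from the axis
lies beyond [h_k] iff the cosine of the angle between [alpha] and the normal of
[h_k] exceeds [apothem / t].  As these normals are equally spaced, the planes
that separate a point from the axis form a cyclic arc of fewer than [n/2 + 1]
consecutive indices, and every such arc occurs.  A region is thus a side of [h]
together with a cyclic arc; the set separating two regions is the symmetric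
difference of their arcs (plus [h] if the sides differ), and its cardinality
depends only on the lengths of the arcs and on the offset between their starting
points, which is what makes the blocks circulant.  The arc labelled [x] below
[h] is the mirror image of the one above, whence the factors [J] and [K]. *)

(** * Regions as sign cells *)

Section Arrangement.
Variables (R : realType) (d : nat) (I : finType) (A : I -> hyperplane R d).

Definition sign_cell (S : {set I}) : set 'rV[R]_d :=
  [set x | forall i, if i \in S then 0 < heval (A i) x else heval (A i) x < 0].

Definition pos_index (x : 'rV[R]_d) : {set I} := [set i | 0 < heval (A i) x]%SET.

Lemma heval_continuous (H : hyperplane R d) : continuous (heval H).
Proof.
have sum_continuous : continuous (fun x : 'rV[R]_d => \sum_(i < d) H.1 0 i * x 0 i).
  apply: continuous_big => [|i _ x]; first exact: add_continuous.
  by apply: continuousM; [exact: cst_continuous|exact: coord_continuous].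
by move=> x; exact: (continuousB (@sum_continuous x) (@cst_continuous _ _ H.2 x)).
Qed.

Lemma heval_segment (H : hyperplane R d) (x y : 'rV[R]_d) (t : R) :
  heval H (x + t *: (y - x)) = (1 - t) * heval H x + t * heval H y.
Proof.
rewrite /heval.
have -> : \sum_(i < d) H.1 0 i * (x + t *: (y - x)) 0 i =
    \sum_(i < d) ((1 - t) * (H.1 0 i * x 0 i) + t * (H.1 0 i * y 0 i)).
  by apply: eq_bigr => i _; rewrite !mxE; ring.
by rewrite big_split /= -!mulr_sumr; ring.
Qed.

Lemma arr_complementP (x : 'rV[R]_d) :
  arr_complement A x <-> forall i, heval (A i) x != 0.
Proof.
split=> [Ax i|Ax [i _] /= h]; last by move: (Ax i); rewrite h eqxx.
by apply/eqP => h; apply: Ax; exists i.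
Qed.

Lemma sign_cell_complement (S : {set I}) : sign_cell S `<=` arr_complement A.
Proof.
by move=> x Sx; apply/arr_complementP => i; move: (Sx i); case: ifP => _ h;
  rewrite ?(gt_eqF h) ?(lt_eqF h).
Qed.

Lemma pos_index_cell (x : 'rV[R]_d) :
  arr_complement A x -> sign_cell (pos_index x) x.
Proof.
move=> /arr_complementP Ax i; rewrite inE; case: ltP => // h.
by rewrite lt_neqAle Ax h.
Qed.

Lemma pos_index_sign_cell (S : {set I}) x : sign_cell S x -> pos_index x = S.
Proof.
move=> Sx; apply/setP => i; rewrite inE; move: (Sx i).
by case: ifP => _ // /ltW; rewrite leNgt => /negbTE.
Qed.

(** A form that vanishes nowhere on a connected set keeps its sign there, so the component lies in
    the cell. Conversely a cell is convex, and the segment from [x] to [y] is a connected subset of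
    the complement. *)
Lemma sign_cell_connected_component (S : {set I}) x :
  sign_cell S x -> connected_component (arr_complement A) x = sign_cell S.
Proof.
move=> Sx; apply/seteqP; split=> y.
  move=> Ky i; set K := connected_component _ x in Ky *.
  have : connected (heval (A i) @` K).
    apply: connected_continuous_connected; first exact: component_connected.
    exact/continuous_subspaceT/heval_continuous.
  move=> /connected_intervalP itvK.
  have K0 : ~ (heval (A i) @` K) 0.
    move=> [z Kz] /eqP; apply/negP; move: i {itvK}; apply/arr_complementP.
    exact: connected_component_sub Kz.
  have Kix : (heval (A i) @` K) (heval (A i) x).
    by exists x => //; apply: connected_component_refl; exact: sign_cell_complement Sx.
  have Kiy : (heval (A i) @` K) (heval (A i) y) by exists y.
  case: ifP (Sx i) => _ x0; rewrite ltNge; apply/negP => y0; apply: K0.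
    by apply: (itvK _ _ Kiy Kix); rewrite y0 ltW.
  by apply: (itvK _ _ Kix Kiy); rewrite y0 ltW.
move=> Sy; pose f (t : R) : 'rV[R]_d := x + t *: (y - x).
have fc : continuous f.
  move=> t; apply: (continuousD (@cst_continuous _ _ x t)).
  exact: (@continuousZr_tmp _ _ _ id (y - x)).
apply: (@connected_component_max _ _ (f @` `[0, 1])).
- by exists 0; [rewrite /= in_itv /= lexx ler01|rewrite /f scale0r addr0].
- move=> _ [t /= /[!in_itv] /= /andP[t0 t1] <-].
  apply: (@sign_cell_complement S) => i; rewrite heval_segment.
  by case: ifP (Sx i) (Sy i) => _ ? ?; nra.
- apply: connected_continuous_connected; first exact: segment_connected.
  exact: continuous_subspaceT.
- by exists 1; [rewrite /= in_itv /= lexx ler01|rewrite /f scale1r addrC subrK].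
Qed.

Lemma regions_sign_cell (C : set 'rV[R]_d) :
  regions A C <-> exists2 S, sign_cell S !=set0 & C = sign_cell S.
Proof.
split=> [[x Ax ->]|[S [x Sx] ->]].
  have Sx := pos_index_cell Ax.
  by exists (pos_index x); [exists x|exact: sign_cell_connected_component].
exists x; first exact: sign_cell_complement Sx.
by rewrite (sign_cell_connected_component Sx).
Qed.

Lemma sign_cell_pos (S : {set I}) i : sign_cell S !=set0 ->
  sign_cell S `<=` pos_side (A i) <-> i \in S.
Proof.
move=> [x Sx]; split=> [/(_ x Sx) /= h|iS y /(_ i)]; last by rewrite iS.
by rewrite -(pos_index_sign_cell Sx) inE.
Qed.

Lemma sign_cell_neg (S : {set I}) i : sign_cell S !=set0 ->
  sign_cell S `<=` neg_side (A i) <-> i \notin S.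
Proof.
move=> [x Sx]; split=> [/(_ x Sx) /= h|/negbTE iS y /(_ i)]; last by rewrite iS.
by rewrite -(pos_index_sign_cell Sx) inE -leNgt ltW.
Qed.

(** Nonemptiness matters: an empty cell lies on both sides of every hyperplane. *)
Lemma sep_sign_cell (S S' : {set I}) : sign_cell S !=set0 ->
  sign_cell S' !=set0 ->
  sep A (sign_cell S) (sign_cell S') = [set i | (i \in S) (+) (i \in S')]%SET.
Proof.
move=> S0 S'0; apply/setP => i; rewrite !inE; apply/asboolP/idP.
  by case=> -[] + h; move: h; rewrite sign_cell_pos // sign_cell_neg //;
    [move=> /negbTE -> ->|move=> -> /negbTE ->].
case: (boolP (i \in S)) => iS; case: (boolP (i \in S')) => iS' //= _.
  by left; rewrite sign_cell_pos // sign_cell_neg.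
by right; rewrite sign_cell_pos // sign_cell_neg.
Qed.

End Arrangement.

(** * Arcs cut out by the planes *)

Section Trigonometry.
Variable R : realType.
Implicit Types (a b u y : R) (n k r x : nat).

Lemma cosD2piz a (m : int) : cos (a + 2 * pi * m%:~R) = cos a.
Proof.
have cosn b (j : nat) : cos (b + 2 * pi * j%:R) = cos b.
  have -> : 2 * pi * j%:R = pi *+ 2 *+ j :> R.
    by rewrite -[RHS]mulr_natr -[pi *+ 2]mulr_natr [2 * pi]mulrC.
  exact: (periodicn (@cosD2pi R)).
case: m => j; first exact: cosn.
by rewrite -(cosn _ j.+1) NegzE mulrNz mulrN subrK.
Qed.

Lemma ler_cos_pi a b : 0 <= a -> a <= b -> b <= pi -> cos b <= cos a.
Proof.
move=> a0 ab bpi; rewrite leNgt ltr_cos -?leNgt // in_itv /=; lra.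
Qed.

(** The range of [y] is one period. Reflecting a negative [y] to [- y], and a [y] beyond [pi] to
    [2 pi - y], brings the comparison into [[0, pi]], where [cos] decreases. *)
Lemma cos_gt_arc b y : 0 < b -> b < pi -> - b < y -> y <= 2 * pi - b ->
  (cos b < cos y) = (y < b).
Proof.
move=> b0 bpi yb1 yb2; have := @pi_gt0 R => pi0.
have [y0|y0] := ltP y 0.
  by rewrite -(cosN y) ltr_cos ?in_itv /=; lra.
have [ypi|ypi] := leP y pi.
  by rewrite ltr_cos ?in_itv /=; lra.
rewrite -(cosN y) -(cosD2piz (- y) 1) mulr1 ltr_cos ?in_itv /=; lra.
Qed.

Lemma polar_coordinates a b :
  exists t alpha : R, [/\ 0 <= t, a = t * cos alpha & b = t * sin alpha].
Proof.
pose t := Num.sqrt (a ^+ 2 + b ^+ 2).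
have t2 : t ^+ 2 = a ^+ 2 + b ^+ 2 by rewrite sqr_sqrtr // addr_ge0 // sqr_ge0.
have t0 : 0 <= t by exact: sqrtr_ge0.
have [tz|tnz] := eqVneq t 0.
  move: t2; rewrite tz expr0n => /esym/eqP.
  rewrite paddr_eq0 ?sqr_ge0 // !sqrf_eq0 => /andP[/eqP-> /eqP->].
  by exists 0, 0; rewrite !mul0r.
have tp : 0 < t by rewrite lt_neqAle eq_sym tnz.
have at1 : -1 <= a / t <= 1.
  rewrite ler_pdivlMr // ler_pdivrMr // mulN1r mul1r -ler_norml.
  by rewrite -ler_sqr ?nnegrE // real_normK ?num_real // t2 lerDl sqr_ge0.
have s2 : t * sin (acos (a / t)) = `|b|.
  rewrite sin_acos // -{1}(ger0_norm t0) -sqrtr_sqr -sqrtrM ?sqr_ge0 //.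
  rewrite -sqrtr_sqr; congr Num.sqrt; rewrite mulrBr mulr1 expr_div_n mulrCA.
  by rewrite divff ?sqrf_eq0 // mulr1 t2; ring.
have c1 : t * cos (acos (a / t)) = a.
  by rewrite acosK ?in_itv //= mulrCA divff // mulr1.
exists t; have [b0|b0] := leP 0 b.
  by exists (acos (a / t)); split=> //; rewrite s2 ger0_norm.
exists (- acos (a / t)); rewrite cosN sinN; split=> //.
by rewrite mulrN s2 ltr0_norm // opprK.
Qed.

End Trigonometry.

(* [k] is one of [x, ..., x + r - 1] mod [n]; reducing [x] first keeps the natural
   subtraction exact. *)
Definition in_arc (n r x k : nat) : bool := ((k + (n - x %% n)) %% n < r)%N.

Section ArcGeometry.
Variables (R : realType) (n : nat).
Hypothesis n_ge3 : (3 <= n)%N.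
Implicit Types (a b m theta : R) (k r x : nat).

Let n_gt0 : (0 : R) < n%:R. Proof. by rewrite ltr0n; lia. Qed.

(** Up to full turns, the angle depends on [k] only through its offset from [x] modulo [n], the
    quantity that [in_arc] tests. *)
Lemma edge_angle_mod k x : exists z : int,
  pi / n%:R * (2 * k%:R + 1) =
  pi / n%:R * (2 * ((k + (n - x %% n)) %% n)%N%:R + 2 * (x %% n)%N%:R + 1)
    + 2 * pi * z%:~R :> R.
Proof.
(* The quotient counts the full turns, less the one added by [n - x %% n]. *)
set s := (_ %% n)%N; exists (((k + (n - x %% n)) %/ n)%N%:Z - 1).
have e : k%:R + (n%:R - (x %% n)%N%:R) =
    ((k + (n - x %% n)) %/ n)%N%:R * n%:R + s%:R :> R.
  by rewrite -natrB ?(ltnW (ltn_pmod _ _)) -?natrD -?natrM -?natrD -?divn_eq //; lia.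
have -> : k%:R = ((k + (n - x %% n)) %/ n)%N%:R * n%:R + s%:R
    - (n%:R - (x %% n)%N%:R) :> R by rewrite -e; ring.
rewrite intrB -pmulrn; field; exact: lt0r_neq0.
Qed.

(* Numbering the angles from the first one, [u], above [- beta], those of the next [n]
   steps increase within ]-beta, 2 pi - beta], where [cos] exceeds [cos beta] exactly
   below [beta]. *)
Lemma cos_positive_arc (beta gamma : R) : 0 < beta -> beta < pi / 2 ->
  exists r x, [/\ (r <= (n + 1) %/ 2)%N, (1 <= x <= n)%N &
    forall k, (cos beta < cos (pi / n%:R * (2 * k%:R + 1) - gamma)) = in_arc n r x k].
Proof.
move=> beta0 beta1; have pi0 := @pi_gt0 R; set dlt := pi / n%:R.
have dlt0 : 0 < dlt by rewrite divr_gt0.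
have ndlt : n%:R * dlt = pi by rewrite mulrCA divff ?mulr1 // lt0r_neq0.
(* [j] is the least integer whose angle [u] exceeds [- beta]. *)
pose j := Num.floor (((gamma - beta) / dlt - 1) / 2) + 1.
pose u := dlt * (2 * j%:~R + 1) - gamma.
have [u1 u2] : - beta < u /\ u <= - beta + 2 * dlt.
  have e : dlt * (2 * (((gamma - beta) / dlt - 1) / 2) + 1) = gamma - beta.
    by field; exact: lt0r_neq0.
  have := floor_le (((gamma - beta) / dlt - 1) / 2).
  have := floorD1_gt (((gamma - beta) / dlt - 1) / 2).
  rewrite /u /j !intrD mulr1z; move: e.
  set f := (Num.floor _)%:~R; set g := (_ / 2) => e h1 h2.
  have := ler_wpM2l (ltW dlt0) h2; have : dlt * g < dlt * (f + 1) by rewrite ltr_pM2l.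
  by move: e; rewrite !mulrDr; split; lra.
pose x0 := `|(j %% n)%Z|%N; pose w := (j %/ n)%Z.
have nz : (n%:Z != 0)%R by lia.
have jE : j = w * n%:Z + x0%:Z.
  by rewrite /x0 gez0_abs ?modz_ge0 // /w -divz_eq.
have x0n : (x0 < n)%N.
  by rewrite -ltz_nat /x0 gez0_abs ?modz_ge0 // ltz_pmod //; lia.
(* Labels run over [1..n], so the residue 0 is represented by [n]. *)
pose x := if x0 == 0%N then n else x0.
have xn : (x %% n = x0)%N.
  by rewrite /x; case: eqP => [->|_]; rewrite ?modnn // modn_small.
have exr : exists r, beta <= u + 2 * dlt * r%:R.
  exists (Num.bound ((beta - u) / (2 * dlt))).
  have /ltW := unstable.ltr_bound ((beta - u) / (2 * dlt)).
  by rewrite ler_pdivrMr ?(mulr_gt0 _ dlt0) // => h; rewrite -lerBlDl [leRHS]mulrC.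
(* The first step whose angle reaches [beta] is also the number of angles below [beta], hence the
   length of the arc. *)
exists (ex_minn exr), x.
case: ex_minnP => r hr r_min.
have lt_r s : (u + 2 * dlt * s%:R < beta) = (s < r)%N.
  have [rs|sr] := leqP r s.
    apply/negbTE; rewrite -leNgt; apply: le_trans hr _.
    by rewrite lerD2l ler_wpM2l ?ler_nat //; lra.
  by rewrite ltNge; apply: contraTN sr => /r_min; rewrite -leqNgt.
split.
- case: r => [//|r] in hr r_min lt_r *.
  have := lt_r r; rewrite ltnSn => hr'.
  (* The length is now [r.+1]: the first and last angles, [2 dlt r] apart, lie in []-beta, beta[],
     which is shorter than [pi = n dlt]; hence [2 r < n]. *)
  have : 2 * dlt * r%:R < n%:R * dlt by rewrite ndlt; lra.
  rewrite mulrAC ltr_pM2r // -natrM ltr_nat; clear; lia.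
- by move: n_ge3 x0n; rewrite /x; clear; case: eqP; lia.
- move=> k; have [z ->] := edge_angle_mod k x; rewrite /in_arc -lt_r xn.
  set s := (_ %% n)%N.
  have sn : s%:R + 1 <= n%:R :> R by rewrite natr1 ler_nat ltn_pmod // ltnW // ltnW.
  have -> : dlt * (2 * s%:R + 2 * x0%:R + 1) + 2 * pi * z%:~R - gamma =
      u + 2 * dlt * s%:R + 2 * pi * (z - w)%:~R.
    rewrite /u jE intrB intrD intrM -!pmulrn -ndlt; ring.
  rewrite cosD2piz; apply: cos_gt_arc => //; first lra.
    by apply: lt_le_trans u1 _; rewrite lerDl mulr_ge0 ?ler0n //; lra.
  have := ler_wpM2l (ltW dlt0) sn; rewrite mulrDr [dlt * n%:R]mulrC ndlt; lra.
Qed.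

(** In polar coordinates the form is [t] times the cosine of an angle. If [t <= m] the arc is empty;
    otherwise the threshold is [cos beta] with [beta = acos (m / t)], and [m > 0] makes
    [beta < pi / 2]. *)
Lemma halfplanes_arc (m theta a b : R) : 0 < m ->
  exists r x, [/\ (r <= (n + 1) %/ 2)%N, (1 <= x <= n)%N &
    forall k, (m < a * cos (theta + pi / n%:R * (2 * k%:R + 1))
                 + b * sin (theta + pi / n%:R * (2 * k%:R + 1))) = in_arc n r x k].
Proof.
move=> m0; have [t [alpha [t0 -> ->]]] := polar_coordinates a b.
have fE k : t * cos alpha * cos (theta + pi / n%:R * (2 * k%:R + 1))
    + t * sin alpha * sin (theta + pi / n%:R * (2 * k%:R + 1))
    = t * cos (pi / n%:R * (2 * k%:R + 1) - (alpha - theta)).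
  have -> : pi / n%:R * (2 * k%:R + 1) - (alpha - theta) =
    (theta + pi / n%:R * (2 * k%:R + 1)) - alpha by ring.
  by rewrite cosB; ring.
have [tm|mt] := leP t m.
  exists 0%N, 1%N; split=> [//||k]; first by lia.
  rewrite fE /in_arc ltn0; apply/negbTE; rewrite -leNgt.
  by apply: le_trans tm; rewrite ler_piMr // cos_le1.
have t1 : 0 < t by exact: lt_trans mt.
have mt1 : 0 < m / t < 1 by rewrite divr_gt0 //= ltr_pdivrMr // mul1r.
have cosbeta : cos (acos (m / t)) = m / t by rewrite acosK // in_itv /=; lra.
have beta0 : 0 < acos (m / t) by apply: acos_gt0; lra.
have beta1 : acos (m / t) < pi / 2.
  have := @pi_gt0 R => pi0.
  by rewrite -ltr_cos ?in_itv /= ?cos_pihalf ?cosbeta ?acos_lepi; lra.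
have [r [x [rp xn h]]] := cos_positive_arc (alpha - theta) beta0 beta1.
exists r, x; split=> // k.
by rewrite fE -h cosbeta ltr_pdivrMr // mulrC.
Qed.

(** The witness points towards the middle of the arc, at distance [m / M], where [M > 0] lies
    strictly between the cosine at the ends of the arc and the cosine one step outside it. *)
Lemma in_arc_realizable (m theta : R) r x : 0 < m -> (r <= (n + 1) %/ 2)%N ->
  exists a b, forall k,
    let f := a * cos (theta + pi / n%:R * (2 * k%:R + 1))
             + b * sin (theta + pi / n%:R * (2 * k%:R + 1)) in
    if in_arc n r x k then m < f else f < m.
Proof.
move=> m0; case: r => [_|r rp].
  by exists 0, 0 => k; rewrite /in_arc ltn0 !mul0r addr0.
set dlt := pi / n%:R; have pi0 := @pi_gt0 R.
have dlt0 : 0 < dlt by rewrite divr_gt0.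
have ndlt : n%:R * dlt = pi by rewrite mulrCA divff ?mulr1 // lt0r_neq0.
have rn : 2 * r%:R + 1 <= n%:R :> R.
  by rewrite -natrM natr1 ler_nat; move: rp; clear; lia.
have rdlt : 2 * (dlt * r%:R) + dlt <= pi.
  by have := ler_wpM2l (ltW dlt0) rn; rewrite -ndlt; lra.
have r0 : 0 <= dlt * r%:R by rewrite mulr_ge0 ?ler0n // ltW.
pose c1 := cos (dlt * r%:R); pose c2 := cos (dlt * r%:R + 2 * dlt).
have c1_gt0 : 0 < c1 by apply: cos_gt0_pihalf; lra.
(* With [rdlt], this consequence of [n >= 3] yields [dlt r + 2 dlt <= pi], so both angles stay where
   [cos] decreases. *)
have dltpi : 3 * dlt <= pi.
  by rewrite -ndlt ler_wpM2r ?(ltW dlt0) // (ler_nat R 3).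
have c12 : c2 < c1.
  by rewrite /c1 /c2 ltr_cos ?in_itv /=; lra.
have [M [M0 Mc1 Mc2]] : exists M, [/\ 0 < M, M < c1 & c2 < M].
  have [c20|c20] := leP c2 0; first by exists (c1 / 2); split; lra.
  by exists ((c1 + c2) / 2); split; lra.
(* The [r.+1] directions of the arc average to [mid]; the one at offset [s] deviates from it by
   [dlt (2 s - r)]. *)
pose mid := theta + dlt * (2 * (x %% n)%N%:R + r.+1%:R).
exists (m / M * cos mid), (m / M * sin mid) => k /=.
set phi := theta + dlt * _.
have -> : m / M * cos mid * cos phi + m / M * sin mid * sin phi =
    m * (cos (phi - mid) / M) by rewrite cosB; ring.
have [z zE] := edge_angle_mod k x.
rewrite /in_arc; move: zE; set s := (_ %% n)%N => zE.
have -> : cos (phi - mid) = cos (dlt * (2 * s%:R - r%:R)).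
  rewrite /phi /mid zE -/dlt -(cosD2piz (dlt * (2 * s%:R - r%:R)) z) -natr1.
  by congr cos; ring.
have sn : s%:R + 1 <= n%:R :> R by rewrite natr1 ler_nat ltn_pmod // ltnW // ltnW.
have sn' := ler_wpM2l (ltW dlt0) sn.
have s0 : 0 <= dlt * s%:R by rewrite mulr_ge0 ?ler0n // ltW.
rewrite ltr_pMr // gtr_pMr // ltr_pdivlMr // ltr_pdivrMr // mul1r.
have [sr|rs] := ltnP s r.+1.
  have sr' : s%:R <= r%:R :> R by rewrite ler_nat.
  have := ler_wpM2l (ltW dlt0) sr' => {sn sn' rn} sr''.
  apply: lt_le_trans Mc1 _; rewrite -(cos_norm (dlt * _)); apply: ler_cos_pi.
  - exact: normr_ge0.
  - by rewrite ler_norml mulrBr; lra.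
  - lra.
have rs' : r%:R + 1 <= s%:R :> R by rewrite natr1 ler_nat.
have rs'' := ler_wpM2l (ltW dlt0) rs'.
rewrite !mulrDr !mulr1 in rs'' sn'; rewrite [dlt * n%:R]mulrC ndlt in sn'.
apply: le_lt_trans Mc2; rewrite mulrBr.
have [ypi|ypi] := leP (dlt * (2 * s%:R) - dlt * r%:R) pi.
  by apply: ler_cos_pi => //; lra.
rewrite -(cosN (_ - _)) -(cosD2piz (- _) 1) mulr1; apply: ler_cos_pi; lra.
Qed.

End ArcGeometry.

(** * Symmetric differences of arcs *)

Section ArcDistance.
Variable n : nat.
Hypothesis n_gt0 : (0 < n)%N.

(** Only sums occur, so congruences become equations free of truncated subtraction, fit for [lia]
    and [nia]. *)
Lemma eq_modP a b : reflect (exists u v, a + u * n = b + v * n)%N (a == b %[mod n])%N.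
Proof.
apply: (iffP eqP) => [ab|[u [v e]]].
  exists (b %/ n)%N, (a %/ n)%N.
  by rewrite {1}(divn_eq a n) {2}(divn_eq b n) ab; lia.
by rewrite -(modnMDl u a) addnC e addnC modnMDl.
Qed.

Lemma sum_interval (a b N : nat) :
  (\sum_(s < N) (a <= s < b) = minn b N - minn a N)%N.
Proof.
elim: N => [|N IH]; first by rewrite big_ord0; lia.
by rewrite big_ord_recr /= IH; case: (leqP a N); case: (ltnP N b); lia.
Qed.

Lemma sum_intervals (a b c e N : nat) : (a <= b -> b <= c -> c <= e -> e <= N ->
  \sum_(s < N) ((a <= s < b) || (c <= s < e)) = b - a + (e - c))%N.
Proof.
move=> ab bc ce eN.
transitivity (\sum_(s < N) (a <= s < b) + \sum_(s < N) (c <= s < e))%N.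
  by rewrite -big_split; apply: eq_bigr => s _ /=; lia.
by rewrite !sum_interval; lia.
Qed.

(* Size of the symmetric difference of two arcs of lengths [i <= j], the second one
   starting [d] steps after the first.  If [d + j > n], the second arc wraps around
   and covers the first [d + j - n] elements of the first arc. *)
Definition arc_dist (i j d : nat) : nat :=
  if (d < i)%N then (j - i + 2 * d)%N
  else if (d + j <= n)%N then (i + j)%N
  else if (d + j - n <= i)%N then (i + j - 2 * (d + j - n))%N
  else (j - i)%N.

(** [j < n] excludes the full arcs, which coincide whatever their offset. *)
Lemma arc_dist_eq0 i j d : (i <= j)%N -> (j < n)%N -> (d < n)%N ->
  arc_dist i j d = 0%N -> i = j /\ (j = 0%N \/ d = 0%N).
Proof. by rewrite /arc_dist; do 3?case: ifP; lia. Qed.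

(* The reflection that preserves the first arc sends offset [d] to [i - j - d]. *)
Lemma arc_dist_sym i j d d' : (i <= j)%N -> (i + j <= n.+1)%N -> (j <= n)%N ->
  (d < n)%N -> (d' < n)%N ->
  (d + d' + j == i %[mod n])%N -> arc_dist i j d = arc_dist i j d'.
Proof.
move=> ij ijn jn dn d'n; rewrite eqn_mod_dvd; last lia.
case/dvdnP => t e.
(* [d + d' + j - i = t n] is less than [3 n], which leaves three values of [t]. *)
have : (t < 3)%N by rewrite -(ltn_pmul2r n_gt0) -e; lia.
by case: t e => [|[|[|]]] // e _; rewrite /arc_dist; do 6?case: ifP; lia.
Qed.

(** Counted from the start of the first arc, the symmetric difference is in each case a union of two
    intervals of [[0, n[]. If [d < i], then [i + j <= n.+1] gives [d + j <= n]: a second arc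
    starting inside the first does not wrap around. *)
Lemma sum_arc_dist i j d : (i <= j)%N -> (i + j <= n.+1)%N -> (j <= n)%N -> (d < n)%N ->
  (\sum_(s < n) ((s < i) (+) ((s + (n - d)) %% n < j)) = arc_dist i j d)%N.
Proof.
move=> ij ijn jn dn.
have wrap (s : 'I_n) : ((s + (n - d)) %% n = if d <= s then s - d else s + n - d)%N.
  have sn := ltn_ord s; case: leqP => ds; last by rewrite modn_small; lia.
  have -> : (s + (n - d) = s - d + n)%N by lia.
  by rewrite modnDr modn_small; lia.
have step a b c e : (a <= b -> b <= c -> c <= e -> e <= n ->
    (forall s : 'I_n, (s < i) (+) ((s + (n - d)) %% n < j) =
       ((a <= s < b) || (c <= s < e))) ->
    \sum_(s < n) ((s < i) (+) ((s + (n - d)) %% n < j)) = b - a + (e - c))%N.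
  move=> ab bc ce en h; rewrite -(sum_intervals ab bc ce en).
  by apply: eq_bigr => s _; rewrite h.
rewrite /arc_dist; case: ifP => di.
  rewrite (step 0 d i (d + j))%N; try lia.
  move=> s; rewrite wrap; have := ltn_ord s.
  by case: (leqP d s); case: (ltnP s i) => /=; lia.
case: ifP => dj.
  rewrite (step 0 i d (d + j))%N; try lia.
  move=> s; rewrite wrap; have := ltn_ord s.
  by case: (leqP d s); case: (ltnP s i) => /=; lia.
case: ifP => dji.
  rewrite (step (d + j - n) i d n)%N; try lia.
  move=> s; rewrite wrap; have := ltn_ord s.
  by case: (leqP d s); case: (ltnP s i) => /=; lia.
rewrite (step i (d + j - n) d n)%N; try lia.
move=> s; rewrite wrap; have := ltn_ord s.
by case: (leqP d s); case: (ltnP s i) => /=; lia.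
Qed.

Definition signed_arc (b : bool) (r x : nat) : {set option 'I_n} :=
  [set o : option 'I_n | if o is Some k then in_arc n r x k else b]%SET.

Lemma shift_mod (s z w d : nat) : (d <= n)%N -> (z + d == w %[mod n])%N ->
  (((s + z) %% n + (n - w %% n)) %% n = (s + (n - d)) %% n)%N.
Proof.
move=> dn zdw; apply/eqP.
rewrite -(eqn_modDr (w %% n)) -addnA subnK ?(ltnW (ltn_pmod _ _)) //.
rewrite modnDr modn_mod -(eqP zdw) modnDmr.
have -> : (s + (n - d) + (z + d) = s + z + n)%N by lia.
by rewrite modnDr.
Qed.

Lemma card_signed_arc b b' i j z w d : (i <= j)%N -> (i + j <= n.+1)%N ->
  (j <= n)%N -> (d < n)%N -> (z + d == w %[mod n])%N ->
  #|[set o : option 'I_n | (o \in signed_arc b i z) (+) (o \in signed_arc b' j w)]%SET|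
    = ((b (+) b') + arc_dist i j d)%N.
Proof.
move=> ij ijn jn dn zdw.
pose S := [set k : 'I_n | in_arc n i z k (+) in_arc n j w k]%SET.
have -> : [set o : option 'I_n | (o \in signed_arc b i z) (+) (o \in signed_arc b' j w)]%SET
    = if b (+) b' then (None |: [set Some k | k in S])%SET else [set Some k | k in S]%SET.
  apply/setP => -[k|].
    have memS : (Some k \in [set Some k | k in S]%SET) = (k \in S).
      by rewrite mem_imset // => ? ? [].
    transitivity (k \in S); first by rewrite !inE.
    by case: ifP; rewrite ?in_setU1 memS.
  rewrite !inE; case: ifP => _; rewrite ?inE //.
  by apply/esym/negbTE/imsetP => -[].
have cardS : #|[set Some k | k in S]%SET| = arc_dist i j d.
  rewrite card_imset; last by move=> ? ? [].
  rewrite -sum1dep_card big_mkcond -(sum_arc_dist ij ijn jn dn).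
  (* Numbering the planes from [z] makes the first arc start at 0, as in [sum_arc_dist]. *)
  pose h (s : 'I_n) := Ordinal (ltn_pmod (s + z) n_gt0).
  have h_inj : injective h.
    move=> s t /(congr1 val) /= /eqP; rewrite eqn_modDr !modn_small // => /eqP.
    exact: val_inj.
  rewrite (reindex_inj h_inj) /=; apply: eq_bigr => s _.
  rewrite /in_arc /= (shift_mod _ (ltnW dn) zdw).
  by rewrite (@shift_mod s z z 0) ?addn0 // subn0 modnDr modn_small.
case: ifP => _; last exact: cardS.
rewrite cardsU1 cardS; congr (_ + _)%N.
by rewrite (_ : None \notin _) //; apply/imsetP => -[].
Qed.

Lemma in_arcP r x (k : nat) :
  reflect (exists2 s, (s < r)%N & k == x + s %[mod n])%N (in_arc n r x k).
Proof.
apply: (iffP idP) => [kr|[s sr /eqP ks]].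
  exists ((k + (n - x %% n)) %% n)%N => //.
  rewrite modnDmr -modnDml addnCA subnKC ?(ltnW (ltn_pmod _ _)) //.
  by rewrite modnDr.
rewrite /in_arc -modnDml ks [(x + s)%N]addnC.
rewrite (@shift_mod s x x 0) ?addn0 // subn0 modnDr.
exact: leq_ltn_trans (leq_mod _ _) sr.
Qed.

Lemma arc_plusE r x : arc_plus n r x = signed_arc false r x.
Proof.
apply/setP => -[k|]; last by rewrite inE; apply/negbTE/imsetP => -[].
rewrite mem_imset; last by move=> ? ? [].
rewrite !inE; apply/existsP/in_arcP => [[t kt]|[s sr ks]]; first by exists t.
by exists (Ordinal sr).
Qed.

Lemma arc_minusE r x : (x <= n)%N -> (r <= n)%N ->
  arc_minus n r x = signed_arc false r (2 * n + 2 - x - r).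
Proof.
move=> xn rn.
apply/setP => -[k|]; last by rewrite inE; apply/negbTE/imsetP => -[].
rewrite mem_imset; last by move=> ? ? [].
rewrite !inE; apply/existsP/in_arcP => [[t kt]|[s sr ks]].
  (* The arc is read from its other end, hence [r - 1 - t]; its start [2 - x - r] carries an extra
     [2 n] to keep the subtraction exact. *)
  have tr := ltn_ord t; exists (r - 1 - t)%N; first lia.
  rewrite -(eqn_modDr (x + t)) (eqP kt).
  have -> : (2 * n + 2 - x - r + (r - 1 - t) + (x + t) = n + (n + 1))%N by lia.
  by rewrite !modnDl.
have tr : (r - 1 - s < r)%N by lia.
exists (Ordinal tr) => /=; rewrite -modnDml (eqP ks) modnDml.
have -> : (2 * n + 2 - x - r + s + (x + (r - 1 - s)) = n + (n + 1))%N by lia.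
by rewrite !modnDl.
Qed.

Lemma signed_arc_mod b r x y : (x == y %[mod n])%N -> signed_arc b r x = signed_arc b r y.
Proof. by move=> /eqP xy; apply/setP => -[k|]; rewrite !inE // /in_arc xy. Qed.

End ArcDistance.

(** * Regions of the dihedral model *)

Section DihedralCells.
Variables (R : realType) (n : nat) (c : 'rV[R]_3) (rho theta z0 : R).
Hypothesis n_ge3 : (3 <= n)%N.
Hypothesis rho_gt0 : 0 < rho.

Let D := @dihedral_model R n c rho theta z0.
Let dlt : R := pi / n%:R.
Let psi (k : nat) : R := theta + dlt * (2 * k%:R + 1).

Lemma sum3E (F : 'I_3 -> R) : \sum_(i < 3) F i = F 0 + F 1 + F 2%:R.
Proof.
rewrite !big_ord_recl big_ord0 addr0 addrA; congr (_ + F _ + F _); exact/val_inj.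
Qed.

Lemma heval_None x : heval (D None) x = x 0 2%:R - z0.
Proof. by rewrite /heval sum3E /= !mxE /= !mul0r !add0r mul1r. Qed.

(** [psi k] is the direction of the midpoint of the edge, [rho cos dlt] the apothem, and
    [2 rho sin dlt] the length of the edge. *)
Lemma heval_Some (k : 'I_n) x : heval (D (Some k)) x =
  2 * rho * sin dlt * ((x 0 0 - c 0 0) * cos (psi k)
    + (x 0 1 - c 0 1) * sin (psi k) - rho * cos dlt).
Proof.
have n0 : n%:R != 0 :> R by rewrite pnatr_eq0; lia.
have phi0 : theta + 2 * pi * k%:R / n%:R = psi k - dlt.
  by rewrite /psi /dlt; field.
have phi1 : theta + 2 * pi * k.+1%:R / n%:R = psi k + dlt.
  by rewrite /psi /dlt -natr1; field.
rewrite /heval /D /dihedral_model /vertical_plane /ngon_vertex !sum3E phi0 phi1.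
rewrite !mxE /= cosD cosB sinD sinB.
(* The factor [cos ^+ 2 + sin ^+ 2], inserted in the apothem term, makes the identity polynomial. *)
transitivity (2 * rho * sin dlt * ((x 0 0 - c 0 0) * cos (psi k)
    + (x 0 1 - c 0 1) * sin (psi k)
    - rho * cos dlt * (cos (psi k) ^+ 2 + sin (psi k) ^+ 2))); first by ring.
by rewrite cos2Dsin2 mulr1.
Qed.

Lemma dlt_bounds : 0 < dlt /\ dlt < pi / 2.
Proof.
have pi0 := @pi_gt0 R; have n0 : (0 : R) < n%:R by rewrite ltr0n; lia.
split; first by rewrite divr_gt0.
by rewrite ltr_pM2l // ltf_pV2 ?posrE // (ltr_nat R 2).
Qed.

Lemma scale_gt0 : 0 < 2 * rho * sin dlt.
Proof.
have [d0 d1] := dlt_bounds; rewrite !mulr_gt0 //; apply: sin_gt0_pihalf.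
by rewrite d0.
Qed.

Lemma apothem_gt0 : 0 < rho * cos dlt.
Proof.
have [d0 d1] := dlt_bounds; have := @pi_gt0 R => pi0.
rewrite mulr_gt0 //; apply: cos_gt0_pihalf; lra.
Qed.

(** The positive side of each [h_k] is thus the outer one, and the vertical planes in a sign set are
    those separating its cell from the axis. *)
Lemma heval_centre (k : 'I_n) : heval (D (Some k)) c < 0.
Proof.
rewrite heval_Some !subrr !mul0r addr0 add0r pmulr_rlt0 ?scale_gt0 //.
by rewrite oppr_lt0 apothem_gt0.
Qed.

Lemma dihedral_cell_signed_arc (S : {set option 'I_n}) : sign_cell D S !=set0 ->
  exists r x, [/\ (r <= (n + 1) %/ 2)%N, (1 <= x <= n)%N &
    S = signed_arc n (None \in S) r x].
Proof.
move=> [y Sy]; have [r [x [rp xn h]]] :=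
  halfplanes_arc n_ge3 theta (y 0 0 - c 0 0) (y 0 1 - c 0 1) apothem_gt0.
exists r, x; split=> //; apply/setP => -[k|]; last by rewrite inE.
rewrite -{1}(pos_index_sign_cell Sy) !inE heval_Some.
by rewrite pmulr_rgt0 ?scale_gt0 // subr_gt0 h.
Qed.

Lemma signed_arc_cell_nonempty b r x : (r <= (n + 1) %/ 2)%N ->
  sign_cell D (signed_arc n b r x) !=set0.
Proof.
move=> rp; have [u [v uv]] := in_arc_realizable n_ge3 theta x apothem_gt0 rp.
exists (pt3 (c 0 0 + u) (c 0 1 + v) (z0 + (if b then 1 else -1))) => -[k|]; rewrite inE.
  rewrite heval_Some !mxE /= pmulr_rgt0 ?pmulr_rlt0 ?scale_gt0 // subr_gt0 subr_lt0.
  by rewrite [c 0 0 + u]addrC [c 0 1 + v]addrC !addrK; exact: uv.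
by rewrite heval_None !mxE /= addrC addKr; case: b; rewrite ?ltr01 ?ltrN10.
Qed.

(* Both kinds of labels in terms of arcs: {h_(1-x), h_(-x), ..., h_(2-x-r)} is the arc of
   length [r] that starts at [2 - x - r] mod [n]. *)
Definition dihedral_set (b : bool) (r x : nat) : {set option 'I_n} :=
  if b then signed_arc n true r x else signed_arc n false r (2 * n + 2 - x - r).

Lemma dihedral_set_nonempty b r x : (r <= (n + 1) %/ 2)%N ->
  sign_cell D (dihedral_set b r x) !=set0.
Proof. by case: b; exact: signed_arc_cell_nonempty. Qed.

Lemma dihedral_cellP (S : {set option 'I_n}) : sign_cell D S !=set0 ->
  exists b r x, [/\ (r <= (n + 1) %/ 2)%N, (1 <= x <= n)%N & S = dihedral_set b r x].
Proof.
move=> /dihedral_cell_signed_arc; case: (None \in S) => -[r [x [rp xn ->]]].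
  by exists true, r, x.
(* The new label [x'] solves [2 - x' - r = x] modulo [n]; the successor of a residue lies in
   [1..n]. *)
exists false, r, ((2 * n + 1 - x - r) %% n).+1; split=> //=.
  by rewrite ltn_pmod //; lia.
apply: signed_arc_mod; set y := ((2 * n + 1 - x - r) %% n)%N.
have yn : (y < n)%N by rewrite ltn_pmod //; lia.
rewrite -(eqn_modDr (y + r)).
have -> : (2 * n + 2 - y.+1 - r + (y + r) = n + (n + 1))%N by lia.
rewrite addnCA /y modnDml.
have -> : (2 * n + 1 - x - r + (x + r) = n + (n + 1))%N by lia.
by [].
Qed.

Definition on_side (b : bool) : set 'rV[R]_3 :=
  if b then pos_side (horizontal_plane z0) else neg_side (horizontal_plane z0).

Lemma on_side_None b (S : {set option 'I_n}) : sign_cell D S !=set0 ->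
  sign_cell D S `<=` on_side b <-> (None \in S) = b.
Proof.
move=> S0; case: b => /=; first exact: (sign_cell_pos None S0).
by split=> [/(sign_cell_neg None S0)/negbTE|/negbT/(sign_cell_neg None S0)].
Qed.

Lemma in_arc0 x k : in_arc n 0 x k = false.
Proof. by rewrite /in_arc ltn0. Qed.

(** [x] is free, since an arc of length 0 is empty wherever it starts. *)
Lemma cylinder_region b x (C : set 'rV[R]_3) : regions D C -> C `<=` on_side b ->
  C `<=` @cylinder R n c rho theta z0 -> C = sign_cell D (signed_arc n b 0 x).
Proof.
move=> /regions_sign_cell[S S0 ->] /(on_side_None _ S0) Sb Scyl; congr sign_cell.
have [y Sy] := S0; apply/setP => -[k|]; rewrite !inE ?Sb // in_arc0.
apply/negbTE/(sign_cell_neg (Some k) S0) => {Sy}y /Scyl/(_ k).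
by rewrite nmulr_lgt0 // heval_centre.
Qed.

(** The sign set of the cell inside the cylinder contains no vertical plane, so the separating set
    gives the vertical planes of [C], and the side decides [None]. *)
Lemma sep_region b r x y (C : set 'rV[R]_3) : regions D C -> C `<=` on_side b ->
  sep D (sign_cell D (signed_arc n b 0 y)) C = signed_arc n false r x ->
  C = sign_cell D (signed_arc n b r x).
Proof.
move=> /regions_sign_cell[S S0 ->] /(on_side_None _ S0) Sb.
rewrite sep_sign_cell //; last exact: signed_arc_cell_nonempty.
move=> e; congr sign_cell; apply/setP => -[k|]; last by rewrite Sb inE.
by move/setP/(_ (Some k)): e; rewrite !inE in_arc0.
Qed.

Lemma sep_signed_arc b r x y : (r <= (n + 1) %/ 2)%N ->
  sep D (sign_cell D (signed_arc n b 0 y)) (sign_cell D (signed_arc n b r x))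
    = signed_arc n false r x.
Proof.
move=> rp; rewrite sep_sign_cell; try exact: signed_arc_cell_nonempty.
by apply/setP => -[k|]; rewrite !inE ?in_arc0 // addbb.
Qed.

Section Labelling.
Variable p : nat.
Hypothesis pE : p = ((n + 1) %/ 2)%N.

(** [k = (r - 1) n + x] is decoded through [k + n - 1 = r n + (x - 1)], which also sends [k = 0] to
    [r = 0]. *)
Lemma dihedral_labelling_exists : dihedral_labelling n p c rho theta z0
  (fun k => sign_cell D (dihedral_set true ((k + n - 1) %/ n) ((k + n - 1) %% n).+1))
  (fun k => sign_cell D (dihedral_set false ((k + n - 1) %/ n) ((k + n - 1) %% n).+1)).
Proof.
have regD b r x : (r <= (n + 1) %/ 2)%N -> regions D (sign_cell D (signed_arc n b r x)).
  move=> rp; apply/regions_sign_cell; exists (signed_arc n b r x) => //.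
  exact: signed_arc_cell_nonempty.
have sideD b r x : (r <= (n + 1) %/ 2)%N ->
    sign_cell D (signed_arc n b r x) `<=` on_side b.
  by move=> rp; apply/on_side_None; [exact: signed_arc_cell_nonempty|rewrite inE].
have cylD b x : sign_cell D (signed_arc n b 0 x) `<=` @cylinder R n c rho theta z0.
  move=> y Sy k; rewrite nmulr_lgt0 ?heval_centre //.
  by move: (Sy (Some k)); rewrite inE in_arc0.
have row0 : ((0 + n - 1) %/ n = 0)%N by rewrite divn_small; lia.
have rowE r x : (1 <= r)%N -> (1 <= x <= n)%N ->
    (((r - 1) * n + x + n - 1) %/ n = r)%N /\ (((r - 1) * n + x + n - 1) %% n).+1 = x.
  move=> r1 xn; have -> : ((r - 1) * n + x + n - 1 = r * n + (x - 1))%N by nia.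
  by rewrite divnMDl ?modnMDl ?divn_small ?modn_small; lia.
split.
- by rewrite row0; split; [exact: regD|exact: (sideD true)|exact: cylD].
- by rewrite row0; split; [exact: regD|exact: (sideD false)|exact: cylD].
- move=> r x /andP[r1 rp] xn; have [-> ->] := rowE r x r1 xn; rewrite row0.
  rewrite pE in rp.
  split; [exact: regD|exact: (sideD true)|].
  by rewrite sep_signed_arc // arc_plusE //; lia.
- move=> r x /andP[r1 rp] xn; have [-> ->] := rowE r x r1 xn; rewrite row0.
  rewrite pE in rp.
  split; [exact: regD|exact: (sideD false)|].
  by rewrite sep_signed_arc // arc_minusE //; lia.
Qed.

Definition label_index (r x : nat) : nat :=
  if r == 0%N then 0%N else ((r - 1) * n + x)%N.

Lemma dihedral_labelling_cells Rp Rm : dihedral_labelling n p c rho theta z0 Rp Rm ->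
  forall r x, (r <= p)%N -> (1 <= x <= n)%N ->
  Rp (label_index r x) = sign_cell D (dihedral_set true r x) /\
  Rm (label_index r x) = sign_cell D (dihedral_set false r x).
Proof.
case=> -[P0 P1 P2] [M0 M1 M2] P M r x rp xn; rewrite /label_index.
have P0E y := @cylinder_region true y _ P0 P1 P2.
have M0E y := @cylinder_region false y _ M0 M1 M2.
case: eqP => [->|/eqP r0]; first by split; [exact: P0E|exact: M0E].
have r1 : (1 <= r <= p)%N by lia.
split.
  have [Pr Ps Psep] := P r x r1 xn.
  apply: (@sep_region true _ _ 0%N) => //.
  by rewrite -P0E Psep arc_plusE //; lia.
have [Mr Ms Msep] := M r x r1 xn.
apply: (@sep_region false _ _ 0%N) => //.
by rewrite -M0E Msep arc_minusE //; lia.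
Qed.

End Labelling.
End DihedralCells.

(** * Positions in the list of regions *)

Section RegionOrder.

Lemma size_flatten_uniform (S : Type) (f : nat -> seq S) m a p :
  (forall r, size (f r) = m) -> size (flatten [seq f r | r <- iota a p]) = (p * m)%N.
Proof. by move=> fm; elim: p a => //= p IH a; rewrite size_cat IH fm mulSn. Qed.

Lemma nth_flatten_uniform (S : Type) (s0 : S) (f : nat -> seq S) m a p r s :
  (forall r, size (f r) = m) -> (r < p)%N -> (s < m)%N ->
  nth s0 (flatten [seq f r | r <- iota a p]) (r * m + s) = nth s0 (f (a + r)%N) s.
Proof.
move=> fm; elim: p a r => // p IH a [|r] rp sm /=; rewrite nth_cat fm.
  by rewrite sm addn0.
rewrite mulSn -addnA ltnNge leq_addr /= addKn IH //.
by rewrite addnS addSn.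
Qed.

(* Position of the region labelled [(b, r, x)] in [region_order], [b] telling whether it
   is above [h]; [r = 0] encodes the two regions inside the cylinder. *)
Definition region_index (n : nat) (b : bool) (r x : nat) : nat :=
  if r == 0%N then (~~ b : nat)
  else (1 + 1 + ((r - 1) * (n + n) + ((if b then 0 else n) + (x - 1))))%N.

Variables (S : Type) (n p : nat) (F G : nat -> S).

Lemma size_region_order : size (region_order n p F G) = (2 * (n * p + 1))%N.
Proof.
rewrite /region_order size_cat (@size_flatten_uniform _ _ (n + n)%N) /=; last first.
  by move=> r; rewrite size_cat !size_map size_iota.
by rewrite !addnn -!mul2n; nia.
Qed.

Lemma nth_region_order s0 b r x : (r <= p)%N -> (1 <= x <= n)%N ->
  nth s0 (region_order n p F G) (region_index n b r x) =
    (if b then F else G) (label_index n r x).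
Proof.
move=> rp xn; rewrite /region_order /region_index /label_index.
case: r rp => [_|r rp] /=; first by case: b.
rewrite subSS subn0 (@nth_flatten_uniform _ _ _ (n + n)%N) //; last 2 first.
- by move=> k; rewrite size_cat !size_map size_iota.
- by case: b; lia.
rewrite add1n nth_cat size_map size_iota.
case: b.
  have -> : (0 + (x - 1) < n)%N by lia.
  by rewrite (nth_map 0%N) ?size_iota ?nth_iota; try lia; congr F; lia.
have -> : (n + (x - 1) < n)%N = false by lia.
by rewrite addKn (nth_map 0%N) ?size_iota ?nth_iota; try lia; congr G; lia.
Qed.

Lemma region_index_surj k : (k < 2 * (n * p + 1))%N -> (0 < n)%N ->
  exists b r x, [/\ (r <= p)%N, (1 <= x <= n)%N & k = region_index n b r x].
Proof.
move=> kn n0; have [k2|k2] := ltnP k 2.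
  exists (k == 0%N), 0%N, 1%N; split=> //.
  by case: k k2 {kn} => [|[|]].
have m0 : (0 < n + n)%N by lia.
pose r := ((k - 2) %/ (n + n))%N; pose s := ((k - 2) %% (n + n))%N.
have kE : (k = 2 + (r * (n + n) + s))%N by rewrite -divn_eq; lia.
have sn : (s < n + n)%N by rewrite ltn_pmod.
have rp : (r < p)%N by rewrite ltn_divLR //; lia.
have [sn'|sn'] := ltnP s n.
  by exists true, r.+1, s.+1; split=> //; rewrite /region_index /= !subSS !subn0 kE.
exists false, r.+1, (s - n).+1; split=> //; first by lia.
by rewrite /region_index /= !subSS !subn0 kE subnKC.
Qed.

Lemma region_index_lt b r x : (r <= p)%N -> (1 <= x <= n)%N ->
  (region_index n b r x < 2 * (n * p + 1))%N.
Proof.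
rewrite /region_index; case: r => [_ _|r rp xn] /=; first by case: b; lia.
by rewrite subSS subn0; case: b; nia.
Qed.

End RegionOrder.

(** * Distances between labelled sign sets *)

Section DihedralDistance.
Variable n : nat.
Hypothesis n_gt0 : (0 < n)%N.

Definition sym_diff_card (S S' : {set option 'I_n}) : nat :=
  #|[set o | (o \in S) (+) (o \in S')]%SET|.

Lemma sym_diff_cardC S S' : sym_diff_card S S' = sym_diff_card S' S.
Proof. by congr #|pred_of_set _|; apply/setP => o; rewrite !inE addbC. Qed.

Lemma sym_diff_card_eq0 S S' : sym_diff_card S S' = 0%N <-> S = S'.
Proof.
split=> [/eqP|->]; last by apply: eq_card0 => o; rewrite !inE addbb.
rewrite cards_eq0 => /eqP/setP h; apply/setP => o.
by move: (h o); rewrite !inE; do 2 case: (o \in _).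
Qed.

Lemma mod_step (z w : nat) : exists2 d, (d < n)%N & (z + d == w %[mod n])%N.
Proof.
exists ((w + (n - z %% n)) %% n)%N; first by rewrite ltn_pmod.
rewrite modnDmr -modnDml addnCA subnKC ?(ltnW (ltn_pmod _ _)) //.
by rewrite modnDr.
Qed.

Lemma dihedral_dist0 b b' r x y : (r <= n)%N ->
  sym_diff_card (dihedral_set n b 0 x) (dihedral_set n b' r y) = ((b (+) b') + r)%N.
Proof.
move=> rn.
have h z w : #|[set o | (o \in signed_arc n b 0 z) (+) (o \in signed_arc n b' r w)]%SET|
    = ((b (+) b') + r)%N.
  have [d dn zd] := mod_step z w.
  rewrite (card_signed_arc _ _ _ _ _ _ _ zd) //; last lia.
  by rewrite /arc_dist; do 3?case: ifP; lia.
by rewrite /sym_diff_card /dihedral_set; case: b b' h => -[] h; apply: h.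
Qed.

(** If the second region is above [h], [d] is the offset between the two arcs; if it is below, the
    offset is [i - j - d] modulo [n], and [arc_dist_sym] makes the two distances equal. *)
Lemma dihedral_dist b b' i j x y d : (1 <= i)%N -> (i <= j)%N -> (i + j <= n.+1)%N ->
  (1 <= x <= n)%N -> (1 <= y <= n)%N -> (d < n)%N ->
  (if b == b' then x + d == y %[mod n] else d + 2 == x + y + i %[mod n])%N ->
  sym_diff_card (dihedral_set n b i x) (dihedral_set n b' j y) =
    ((b (+) b') + arc_dist n i j d)%N.
Proof.
move=> i1 ij ijn xn yn dn hd.
have h z w e : (e < n)%N -> (z + e == w %[mod n])%N ->
    (d = e \/ (e + d + j == i %[mod n])%N) ->
    #|[set o | (o \in signed_arc n b i z) (+) (o \in signed_arc n b' j w)]%SET|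
    = ((b (+) b') + arc_dist n i j d)%N.
  move=> en ze de; rewrite (card_signed_arc _ _ _ _ _ _ _ ze) //; try lia.
  case: de => [->//|de]; congr (_ + _)%N; apply: arc_dist_sym => //; lia.
rewrite /sym_diff_card /dihedral_set; case: b b' hd h => -[] /= hd h.
- by apply: (h _ _ d) => //; left.
- have [e en ze] := mod_step x (2 * n + 2 - y - j).
  apply: (h _ _ e) => //; right.
  case/(eq_modP n_gt0): hd => u [v hd]; case/(eq_modP n_gt0): ze => u' [v' ze].
  apply/(eq_modP n_gt0); exists (u + u')%N, (v + v' + 2)%N; nia.
- have [e en ze] := mod_step (2 * n + 2 - x - i) y.
  apply: (h _ _ e) => //; left.
  case/(eq_modP n_gt0): hd => u [v hd]; case/(eq_modP n_gt0): ze => u' [v' ze].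
  apply/eqP; rewrite -(modn_small dn) -(modn_small en); apply/(eq_modP n_gt0).
  exists (u + v')%N, (v + u' + 2)%N; nia.
- have [e en ze] := mod_step (2 * n + 2 - x - i) (2 * n + 2 - y - j).
  apply: (h _ _ e) => //; right.
  case/(eq_modP n_gt0): hd => u [v hd]; case/(eq_modP n_gt0): ze => u' [v' ze].
  apply/(eq_modP n_gt0); exists (u + u')%N, (v + v')%N; nia.
Qed.

(** Equal sets are at distance 0, which [arc_dist_eq0] exploits. Positions are compared instead of
    labels because in row 0 every [x] gives the same set. *)
Lemma dihedral_set_inj b b' i j x y : (i + j <= n.+1)%N -> (i < n)%N -> (j < n)%N ->
  (1 <= x <= n)%N -> (1 <= y <= n)%N ->
  dihedral_set n b i x = dihedral_set n b' j y ->
  region_index n b i x = region_index n b' j y.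
Proof.
wlog ij : b b' i j x y / (i <= j)%N => [hw ijn ii jj xn yn e|].
  by have [ij|/ltnW ij] := leqP i j; [|symmetry]; apply: hw => //; lia.
move=> ijn ii jn xn yn /sym_diff_card_eq0.
case: i ij ijn {ii} => [_ _|i ij ijn].
  rewrite dihedral_dist0 ?(ltnW jn) // => /eqP; rewrite addn_eq0 => /andP[bb /eqP ->].
  by case: b b' bb => -[].
have [d dn hd] : exists2 d, (d < n)%N &
    (if b == b' then x + d == y %[mod n] else d + 2 == x + y + i.+1 %[mod n])%N.
  case: eqP => _; first exact: mod_step.
  by have [d dn hd] := mod_step 2 (x + y + i.+1); exists d; rewrite // addnC.
rewrite (dihedral_dist _ _ _ _ _ dn hd) // => /eqP; rewrite addn_eq0 => /andP[bb /eqP].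
case/arc_dist_eq0 => // e; case: j e ij jn ijn => [//|j] [<-] _ _ _ [//|d0].
have bE : b = b' by case: b b' bb {hd} => -[].
move: hd; rewrite bE eqxx d0 addn0 => xy.
have -> // : x = y.
have : (x - 1 == y - 1 %[mod n])%N.
  by rewrite -(eqn_modDr 1) !subnK; lia.
rewrite !modn_small; lia.
Qed.

End DihedralDistance.

(** * The blocks *)

Section Blocks.
Variables (T : comNzRingType) (q : T) (n : nat).

Lemma circulantE (s : seq T) (x y : 'I_n) (d : nat) : size s = n -> (d < n)%N ->
  (x + d == y %[mod n])%N -> circulant n s x y = s`_d.
Proof.
move=> sn dn xd; have xn := ltn_ord x; have yn := ltn_ord y.
have n_gt0 : (0 < n)%N by lia.
rewrite mxE /rotr /rot nth_cat size_drop sn subKn ?(ltnW xn) //.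
have dE : d = (if (y < x)%N then n - x + y else y - x)%N.
  apply/eqP; rewrite -(modn_small dn) -[X in _ == X](@modn_small _ n).
    2: by case: (ltnP y x); lia.
  rewrite -(eqn_modDl x) (eqP xd); case: (ltnP y x) => yx; last by rewrite subnKC.
  by rewrite addnA subnKC ?(ltnW xn) // modnDl.
case: ltnP dE => yx ->; first by rewrite nth_drop.
by rewrite nth_take //; lia.
Qed.

Lemma size_C_row i j : (1 <= i)%N -> (i <= j)%N -> (i + j <= n.+1)%N ->
  size (C_row q n i j) = n.
Proof.
move=> i1 ij ijn.
rewrite /C_row !size_cat !size_map size_rev !size_iota !size_nseq; lia.
Qed.

(** The four groups of the row match the four branches of [arc_dist]; at [d + j - n = i] the third
    branch meets the fourth group, both with exponent [j - i]. *)
Lemma nth_C_row i j d : (1 <= i)%N -> (i <= j)%N -> (i + j <= n.+1)%N ->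
  (d < n)%N -> (C_row q n i j)`_d = q ^+ arc_dist n i j d.
Proof.
move=> i1 ij ijn dn; rewrite /C_row /arc_dist.
rewrite nth_cat size_map size_iota; case: ltnP => di.
  by rewrite (nth_map 0%N) ?size_iota // nth_iota.
rewrite nth_cat size_nseq nth_nseq; case: ltnP => dj.
  by have -> : (d + j <= n)%N by lia.
have -> : (d + j <= n)%N = false by lia.
rewrite nth_cat size_map size_rev size_iota; case: ltnP => dm.
  rewrite (nth_map 0%N) ?size_rev ?size_iota // nth_rev ?size_iota // nth_iota; last lia.
  by case: leqP => h; congr (q ^+ _); lia.
rewrite nth_nseq; case: ltnP => h; last lia.
by case: leqP => h'; congr (q ^+ _); lia.
Qed.

Lemma CmxE i j (x y : 'I_n) d : (1 <= i)%N -> (i <= j)%N -> (i + j <= n.+1)%N ->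
  (d < n)%N -> (x + d == y %[mod n])%N -> Cmx q n i j x y = q ^+ arc_dist n i j d.
Proof.
by move=> i1 ij ijn dn xd; rewrite (circulantE (size_C_row i1 ij ijn) dn xd) nth_C_row.
Qed.

(** Row [x] of [J] has its only 1 in column [x + 1], so multiplying by [J] on the left replaces row
    [x] by row [x + 1], cyclically. *)
Lemma Jmx_exp_mul m (M : 'M[T]_n) (x x' y : 'I_n) : (1 < n)%N ->
  (x + m == x' %[mod n])%N -> (Jmx T n ^+ m *m M) x y = M x' y.
Proof.
move=> n1; elim: m x => [|m IH] x xx'.
  rewrite expr0 mul1mx; congr (M _ y); apply: val_inj; move/eqP: xx'.
  by rewrite addn0 !modn_small.
have n0 : (0 < n)%N by lia.
rewrite exprS -mulmxE -mulmxA mxE.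
pose x1 := Ordinal (ltn_pmod x.+1 n0).
rewrite (bigD1 x1) //= big1 ?addr0 => [|k kx].
  rewrite (IH x1) ?(circulantE (d := 1%N)) //= ?mul1r // ?size_nseq; try lia.
  - by rewrite addn1 modn_mod.
  - by rewrite modnDml addSnnS.
have [d dn xd] := mod_step n0 x k.
rewrite (circulantE _ dn xd); last by rewrite /= size_nseq; lia.
have d1 : d != 1%N.
  apply: contraNneq kx => d1; rewrite d1 in xd.
  by apply/eqP/val_inj => /=; rewrite -[LHS](modn_small (ltn_ord k)) -(eqP xd) addn1.
by case: d d1 {dn xd} => [|[|d]] // _ /=; rewrite ?nth_nseq ?if_same mul0r.
Qed.

Definition dup_index m (b : bool) (x : 'I_m) : 'I_(m + m) :=
  if b then lshift m x else rshift m x.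

Lemma block_dupE m k (A B : 'M[T]_(m, k)) b b' (x : 'I_m) (y : 'I_k) :
  block_mx A B B A (dup_index b x) (dup_index b' y) = if b == b' then A x y else B x y.
Proof.
case: b b' => -[] /=; by rewrite ?block_mxEul ?block_mxEur ?block_mxEdl ?block_mxEdr.
Qed.

(** On opposite sides, row [x] of [J^(i-1) K C] is row [n - 1 - (x + i - 1)] of [C] modulo [n], from
    which [y] is at offset [x + y + i]: the one that [dihedral_dist] requires for the labels [x.+1]
    and [y.+1]. *)
Lemma CbarE i j b b' (x y : 'I_n) :
  (1 < n)%N -> (1 <= i)%N -> (i <= j)%N -> (i + j <= n.+1)%N ->
  Cbar q n i j (dup_index b x) (dup_index b' y) =
    q ^+ sym_diff_card (dihedral_set n b i x.+1) (dihedral_set n b' j y.+1).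
Proof.
move=> n1 i1 ij ijn; have n0 : (0 < n)%N by lia.
have xn := ltn_ord x; have yn := ltn_ord y.
rewrite /Cbar block_dupE; case: eqP => bb.
  have [d dn xd] := mod_step n0 x y.
  rewrite (CmxE i1 ij ijn dn xd) (dihedral_dist n0 i1 ij ijn _ _ dn) ?bb ?addbb //.
  by rewrite eqxx addSn; move: xd; rewrite -(eqn_modDr 1) !addn1.
rewrite mxE -mulmxA.
pose x' := Ordinal (ltn_pmod (x + (i - 1)) n0).
rewrite (@Jmx_exp_mul _ _ _ x') //=; last by rewrite modn_mod.
have -> : (Kmx T n *m Cmx q n i j) x' y = Cmx q n i j (rev_ord x') y.
  rewrite mxE (bigD1 (rev_ord x')) //= mxE eqxx mul1r big1 ?addr0 // => k /negbTE kx.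
  by rewrite mxE kx mul0r.
have [d dn xd] := mod_step n0 (rev_ord x') y.
rewrite (CmxE i1 ij ijn dn xd).
rewrite (dihedral_dist n0 i1 ij ijn _ _ dn) //.
  have -> : b (+) b' by case: b b' bb => -[].
  by rewrite exprS.
case: eqP => // _; move: xd => /=; set z := ((x + (i - 1)) %% n)%N => xd.
have zn : (z < n)%N by rewrite ltn_pmod.
rewrite -(eqn_modDr (n - z.+1)).
have -> : (d + 2 + (n - z.+1) = (n - z.+1 + d) + 2)%N by lia.
rewrite -modnDml (eqP xd) modnDml.
rewrite -(eqn_modDr z.+1) -[X in _ == X %[mod _]]addnA subnK //.
have -> : (y + 2 + z.+1 = y + 3 + z)%N by lia.
rewrite modnDmr modnDr; apply/eqP; congr (_ %% n)%N; lia.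
Qed.

Lemma Qbar_posE r b b' (y : 'I_n) : (r <= n)%N -> (0 < n)%N ->
  Qbar_pos q n r (dup_index b (ord0 : 'I_1)) (dup_index b' y) =
    q ^+ sym_diff_card (dihedral_set n b 0 1) (dihedral_set n b' r y.+1).
Proof.
move=> rn n0; rewrite /Qbar_pos /Qbar block_dupE dihedral_dist0 //.
by case: b b' => -[] /=; rewrite !mxE ?add0n ?add1n ?exprS.
Qed.

Variable p : nat.
Hypotheses (n_ge3 : (3 <= n)%N) (pE : p = ((n + 1) %/ 2)%N).

Lemma Vblocks_index (i : 'I_((1 + 1) + \sum_(r < p) (n + n))) :
  (exists b, i = lshift _ (dup_index b (ord0 : 'I_1))) \/
  (exists (r : 'I_p) b (x : 'I_n),
     i = rshift (1 + 1) (tagnat.Rank r (dup_index b x))).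
Proof.
have dup m (k : 'I_(m + m)) : exists b (x : 'I_m), k = dup_index b x.
  by case: (split_ordP k) => x ->; [exists true, x|exists false, x].
case: (split_ordP i) => k ->; [left|right].
  by have [b [x ->]] := dup _ k; exists b; rewrite ord1.
have [b [x e]] := dup _ (tagnat.sig2 k); exists (tagnat.sig1 k), b, x.
by rewrite -e tagnat.sig2K.
Qed.

Lemma val_Vblocks_index0 b :
  lshift (\sum_(r < p) (n + n)) (dup_index b (ord0 : 'I_1))
    = region_index n b 0 1 :> nat.
Proof. by case: b. Qed.

Lemma val_Vblocks_index (r : 'I_p) b (x : 'I_n) :
  (rshift (1 + 1) (tagnat.Rank r (dup_index b x)) : nat) = region_index n b r.+1 x.+1.
Proof.
transitivity (1 + 1 + tagnat.Rank r (dup_index b x))%N => //.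
rewrite tagnat.RankEsum -(big_ord_widen p (fun=> n + n)%N) ?(ltnW (ltn_ord r)) //.
rewrite sum_nat_const card_ord.
by rewrite /region_index !subSS !subn0; case: b.
Qed.

(** Since [2 p <= n + 1], the length condition of the distance lemmas holds for any two rows, and no
    arc is full. *)
Lemma p_bounds r r' : (r <= p)%N -> (r' <= p)%N -> (r + r' <= n.+1)%N /\ (r < n)%N.
Proof. rewrite pE; lia. Qed.

Lemma Vblocks_entry (i j : 'I_((1 + 1) + \sum_(r < p) (n + n))) :
  exists b r x b' r' x', [/\ (r <= p)%N && (1 <= x <= n)%N,
    (r' <= p)%N && (1 <= x' <= n)%N,
    i = region_index n b r x :> nat, j = region_index n b' r' x' :> nat &
    Vblocks q n p i j =
      q ^+ sym_diff_card (dihedral_set n b r x) (dihedral_set n b' r' x')].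
Proof.
have n0 : (0 < n)%N by lia.
have n1 : (1 < n)%N by lia.
case: (Vblocks_index i) => [[b ->]|[r [b [x ->]]]];
  case: (Vblocks_index j) => [[b' ->]|[r' [b' [x' ->]]]].
- exists b, 0%N, 1%N, b', 0%N, 1%N; rewrite !val_Vblocks_index0 n0; split=> //.
  rewrite /Vblocks block_mxEul /Qbar0 /Qbar block_dupE dihedral_dist0 // addn0.
  by case: b b' => -[] /=; rewrite !mxE ?expr0 ?expr1 ?mulr1.
- exists b, 0%N, 1%N, b', r'.+1, x'.+1.
  rewrite val_Vblocks_index0 val_Vblocks_index n0 !ltn_ord; split=> //.
  rewrite /Vblocks block_mxEur.
  transitivity (Qbar_pos q n r'.+1 (dup_index b (ord0 : 'I_1)) (dup_index b' x')).
    (* The block is rewritten as a submatrix of the whole block row, so that both sides become the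
       same entry of it. *)
    by rewrite -[in RHS](mxrowK (fun j : 'I_p => Qbar_pos q n j.+1)) [RHS]mxE.
  by rewrite Qbar_posE //; have [_] := p_bounds (ltn_ord r') (ltn_ord r'); lia.
- exists b, r.+1, x.+1, b', 0%N, 1%N.
  rewrite val_Vblocks_index0 val_Vblocks_index n0 !ltn_ord; split=> //.
  rewrite /Vblocks block_mxEdl sym_diff_cardC.
  transitivity ((Qbar_pos q n r.+1)^T (dup_index b x) (dup_index b' (ord0 : 'I_1))).
    by rewrite -[in RHS](mxcolK (fun j : 'I_p => (Qbar_pos q n j.+1)^T)) [RHS]mxE.
  by rewrite mxE Qbar_posE //; have [_] := p_bounds (ltn_ord r) (ltn_ord r); lia.
- exists b, r.+1, x.+1, b', r'.+1, x'.+1.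
  rewrite !val_Vblocks_index !ltn_ord; split=> //.
  rewrite /Vblocks block_mxEdr.
  pose B (i j : 'I_p) :=
    if (i <= j)%N then Cbar q n i.+1 j.+1 else (Cbar q n j.+1 i.+1)^T.
  transitivity (B r r' (dup_index b x) (dup_index b' x')).
    by rewrite -[B r r'](mxblockK B) [RHS]mxE.
  have [rr' _] := p_bounds (ltn_ord r) (ltn_ord r').
  rewrite /B; case: leqP => h; first by rewrite CbarE.
  (* Below the diagonal the transpose is matched by exchanging the two regions. *)
  by rewrite mxE CbarE 1?sym_diff_cardC //; lia.
Qed.

End Blocks.

Theorem theorem3p3 (T : comNzRingType) (q : T) (R : realType)
    (n p : nat) (hn : (3 <= n)%N) (hp : p = ((n + 1) %/ 2)%N)
    (c : 'rV[R]_3) (rho theta z0 : R) (hrho : 0 < rho) :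
  (exists Rp Rm : nat -> set 'rV[R]_3,
      dihedral_labelling n p c rho theta z0 Rp Rm) /\
  (forall Rp Rm : nat -> set 'rV[R]_3,
      dihedral_labelling n p c rho theta z0 Rp Rm ->
      [/\ uniq (region_order n p Rp Rm),
          [set` region_order n p Rp Rm] =
            regions (@dihedral_model R n c rho theta z0) &
          varchenko q (@dihedral_model R n c rho theta z0) (2 * (n * p + 1))
            (nth set0 (region_order n p Rp Rm)) =
          castmx (Vblocks_dim n p, Vblocks_dim n p) (Vblocks q n p)]).
Proof.
have n_gt0 : (0 < n)%N by lia.
split; first by eexists; eexists; exact: dihedral_labelling_exists.
move=> Rp Rm lab; set A := @dihedral_model R n c rho theta z0.
set s := region_order n p Rp Rm.
have size_s : size s = (2 * (n * p + 1))%N by exact: size_region_order.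
have nth_s b r x : (r <= p)%N -> (1 <= x <= n)%N ->
    nth set0 s (region_index n b r x) = sign_cell A (dihedral_set n b r x).
  move=> rp xn; rewrite nth_region_order //.
  by have [] := dihedral_labelling_cells hn hrho hp lab rp xn; case: b.
have cell0 b r x : (r <= p)%N -> sign_cell A (dihedral_set n b r x) !=set0.
  by rewrite hp; exact: dihedral_set_nonempty.
split.
- apply/(uniqP set0) => i j; rewrite !inE size_s.
  move=> /region_index_surj[//|b [r [x [rp xn ->]]]].
  move=> /region_index_surj[//|b' [r' [x' [rp' xn' ->]]]].
  (* A point of the common cell determines its sign set, so the two sets agree, and with them the
     positions. *)
  rewrite !nth_s // => e; have [y Sy] := cell0 b r x rp.
  have := Sy; rewrite e => /pos_index_sign_cell; rewrite (pos_index_sign_cell Sy).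
  have [? ?] := p_bounds hn hp rp rp'; have [_ ?] := p_bounds hn hp rp' rp.
  exact: dihedral_set_inj.
- apply/seteqP; split=> C /=.
    move=> /(nthP set0)[k]; rewrite size_s => /region_index_surj[//|b [r [x [rp xn ->]]]].
    rewrite nth_s // => <-; apply/regions_sign_cell.
    by exists (dihedral_set n b r x) => //; exact: cell0.
  move=> /regions_sign_cell[S S0 ->].
  have [b [r [x [rp xn ->]]]] := dihedral_cellP hn hrho S0.
  rewrite -hp in rp; rewrite -nth_s // mem_nth // size_s.
  exact: region_index_lt.
- apply/matrixP => i j; rewrite castmxE mxE.
  have [b [r [x [b' [r' [x' [/andP[rp xn] /andP[rp' xn'] /= iE jE ->]]]]]]] :=
    Vblocks_entry q hn hp (cast_ord (esym (Vblocks_dim n p)) i)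
      (cast_ord (esym (Vblocks_dim n p)) j).
  rewrite iE jE !nth_s // sep_sign_cell //; exact: cell0.
Qed.
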